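(* Let $G$ be a graph with a perfect matching. Then $G$ can be covered by a collection of independent edges and a positive number of odd cycles (that is, $G$ has a spanning subgraph each of whose components is a single edge or an odd cycle, with at least one component an odd cycle) if and only if $G$ contains an even subdivision of $T$ as a nice subgraph.
   Context: Graphs are finite and simple. $T$ is the graph on 6 vertices consisting of two vertex-disjoint triangles together with a single edge joining a vertex of one to a vertex of the other. An even subdivision of a graph is obtained by subdividing each edge an even number (possibly zero) of times, i.e. replacing each edge by a path of odd length. A subgraph $H$ of a graph $G$ with a perfect matching is nice if $G-V(H)$ has a perfect matching (the null graph counts as having one). *)

(* Defs.v *)
From mathcomp Require Import all_boot.
Set Implicit Arguments.
Unset Strict Implicit.
Unset Printing Implicit Defensive.

(* A finite simple graph whose vertices are drawn from the finite type U; its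
   vertex set may be a proper subset of U, so that subgraphs of G are again of
   type [graph U]. *)
Record graph (U : finType) := Graph {
  vset : {set U};
  eset : {set {set U}};
  eset_edge : forall e, e \in eset -> (#|e| == 2) && (e \subset vset)
}.

Definition adj (U : finType) (G : graph U) : rel U :=
  fun x y => [set x; y] \in eset G.

Definition subgraph (U : finType) (H G : graph U) : Prop :=
  vset H \subset vset G /\ eset H \subset eset G.

Definition spanning_subgraph (U : finType) (H G : graph U) : Prop :=
  subgraph H G /\ vset H = vset G.

Lemma induced_edge (U : finType) (G : graph U) (S : {set U}) (e : {set U}) :
  e \in [set e in eset G | e \subset S] ->
  (#|e| == 2) && (e \subset vset G :&: S).
Proof.
rewrite inE => /andP[/eset_edge/andP[-> eV] eS].
by rewrite subsetI eV eS.
Qed.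

Definition induced (U : finType) (G : graph U) (S : {set U}) : graph U :=
  Graph (@induced_edge U G S).

Definition del_vertices (U : finType) (G : graph U) (S : {set U}) : graph U :=
  induced G (~: S).

(* The connected component of G containing the vertex x. *)
Definition component (U : finType) (G : graph U) (x : U) : graph U :=
  induced G [set y | connect (adj G) x y].

Definition is_component (U : finType) (C G : graph U) : Prop :=
  exists2 x, x \in vset G & C = component G x.

Definition perfect_matching (U : finType) (G : graph U) (M : {set {set U}}) :=
  [/\ M \subset eset G, trivIset M & cover M = vset G].

Definition has_perfect_matching (U : finType) (G : graph U) : Prop :=
  exists M, perfect_matching G M.

Definition nice (U : finType) (G H : graph U) : Prop :=
  subgraph H G /\ has_perfect_matching (del_vertices G (vset H)).

Definition is_single_edge (U : finType) (G : graph U) : Prop :=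
  exists x y, [/\ x != y, vset G = [set x; y] & eset G = [set [set x; y]]].

Definition is_odd_cycle (U : finType) (G : graph U) : Prop :=
  exists c : seq U,
    [/\ uniq c, 2 < size c, odd (size c),
        vset G = [set:: c] & eset G = [set [set x; next c x] | x in c]].

(* P is a path of odd length (number of edges) whose set of ends is A. *)
Definition is_odd_path (U : finType) (A : {set U}) (P : graph U) : Prop :=
  exists x s,
    [/\ uniq (x :: s), odd (size s), A = [set x; last x s],
        vset P = [set:: x :: s]
      & eset P = [set:: pairmap (fun y z => [set y; z]) x s]].

(* H arises, up to the naming f of the vertices of F, by replacing each edge e
   of F by a path P e of odd length with the same ends, the paths being
   internally disjoint from each other and from the vertices of F. *)
Definition even_subdivision (W U : finType) (F : graph W) (H : graph U) : Prop :=
  exists (f : W -> U) (P : {set W} -> graph U),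
    [/\ {in vset F &, injective f},
        (forall e, e \in eset F ->
           is_odd_path (f @: e) (P e) /\
           vset (P e) :&: f @: vset F = f @: e),
        (forall e1 e2, e1 \in eset F -> e2 \in eset F -> e1 != e2 ->
           vset (P e1) :&: vset (P e2) \subset f @: vset F),
        vset H = f @: vset F :|: \bigcup_(e in eset F) vset (P e)
      & eset H = \bigcup_(e in eset F) eset (P e)].

(* The vertices (b, i) with b fixed form a triangle, and the only other edge
   joins (false, 0) to (true, 0). *)
Definition two_triangles_adj (u v : bool * 'I_3) : bool :=
  if u.1 == v.1 then u.2 != v.2 else (u.2 == ord0) && (v.2 == ord0).

Lemma two_triangles_edge (e : {set bool * 'I_3}) :
  e \in [set [set u; v] | u in [set: bool * 'I_3], v in two_triangles_adj u] ->
  (#|e| == 2) && (e \subset [set: bool * 'I_3]).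
Proof.
case/imset2P=> u v _ uv ->; rewrite subsetT andbT cards2.
have {uv} : two_triangles_adj u v := uv.
by rewrite /two_triangles_adj; case: (u =P v) => // ->; rewrite !eqxx.
Qed.

Definition two_triangles : graph (bool * 'I_3)%type :=
  Graph two_triangles_edge.

(* Main.v *)
Require Import Defs.
From mathcomp Require Import all_boot.
From mathcomp Require Import zify.
Set Implicit Arguments.
Unset Strict Implicit.
Unset Printing Implicit Defensive.

(** A subdivision of the two joined triangles consists of two odd cycles and an
    odd path between them.  The cycles, the edges needed to pair up the (evenly
    many) inner vertices of the path, and a perfect matching of the rest of the
    graph cover everything; this is the easy implication.

    For the converse, let a cover consist of odd cycles and independent edges,
    let [n] exchange the ends of these edges, and let [m] be the partner map of
    a perfect matching.  Alternating between [m] and [n] gives a graph of maximum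
    degree 2 in which the vertices of the odd cycles have degree at most 1.  An
    odd cycle [C] cannot be joined by its alternating paths to itself only: the
    set reached from [C] would be matched by [m] and, with [C] removed, by [n],
    so [C] would be even ([alternating_path_exists]).  Hence some alternating
    path runs from [C] to another odd cycle [C'].  It has odd length and [n]
    pairs its inner vertices, so the union [D] of [C], [C'] and the path is an
    even subdivision of the two joined triangles, and the other cycles and edges
    still cover the complement of [D].

    If no further odd cycle is left, the complement of [D] has a perfect
    matching and [D] is nice.  Otherwise [D] has a perfect matching itself: an
    odd cycle minus one vertex is a path with evenly many vertices, and so is the
    connecting path.  Replacing [C], [C'] and the cover edges on the path by this
    matching gives a cover with two odd cycles fewer, but still some odd cycle.
    This induction is [covers_dumbbell].

    The induction is carried out on lists of cyclic sequences of vertices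
    together with a matchable rest ([covers]); [spanning_covers] and
    [covers_spanning] translate between these and spanning subgraphs given by
    their components.  On the other side, [linkage_subdivision] and
    [subdivision_linkage] translate between even subdivisions and families of
    paths, in which all disjointness conditions become the absence of repetition
    in a single sequence of vertices. *)

(** * Sequences and pairs *)

Lemma uniq_map_inj (T1 T2 : eqType) (f : T1 -> T2) s :
  uniq (map f s) -> {in s &, injective f}.
Proof.
elim: s => //= x s IH /andP[xs us] y z.
rewrite !inE => /predU1P[->|ys] /predU1P[->|zs] // fyz; last exact: IH.
- by rewrite fyz map_f in xs.
- by rewrite -fyz map_f in xs.
Qed.

Lemma uniq_flatten_map_mem (T1 T2 : eqType) (s : T1 -> seq T2) l a b x :
  uniq (flatten (map s l)) -> a \in l -> b \in l -> x \in s a -> x \in s b -> a = b.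
Proof.
elim: l => //= c l IH; rewrite cat_uniq => /and3P[_ /hasPn cl ul].
have cN d : d \in l -> x \in s d -> ~ x \in s c.
  move=> dl xd; apply/negP; apply: cl.
  by apply/flattenP; exists (s d); rewrite ?map_f.
rewrite !inE => /predU1P[->|al] /predU1P[->|bl] // xa xb; last exact: IH.
- by case: (cN b).
- by case: (cN a).
Qed.

Lemma uniq_flatten_mem (T : eqType) (ss : seq (seq T)) s t x :
  uniq (flatten ss) -> s \in ss -> t \in ss -> x \in s -> x \in t -> s = t.
Proof.
by move=> uss; apply: (@uniq_flatten_map_mem _ _ id ss); rewrite map_id.
Qed.

Lemma flatten_map_uniq (T1 T2 : eqType) (s : T1 -> seq T2) l :
  uniq l -> {in l, forall a, uniq (s a)} ->
  (forall a b x, a \in l -> b \in l -> x \in s a -> x \in s b -> a = b) ->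
  uniq (flatten (map s l)).
Proof.
elim: l => //= c l IH /andP[cl ul] us dis; rewrite cat_uniq us ?mem_head //=.
rewrite IH // => [|a al|a b x al bl]; last 2 first.
- by apply: us; rewrite inE al orbT.
- by apply: dis; rewrite inE ?al ?bl orbT.
rewrite andbT; apply/hasPn=> x /flattenP[_ /mapP[a al ->] xa].
apply: contra cl => xc; rewrite (dis c a x) ?mem_head //.
by rewrite inE al orbT.
Qed.

Lemma map_nth_index (T1 : eqType) (T2 : Type) (x0 : T2) (s : seq T1) t :
  uniq s -> size t = size s -> [seq nth x0 t (index x s) | x <- s] = t.
Proof.
case: s => [|y s]; first by case: t.
move=> us st; apply: (@eq_from_nth _ x0); rewrite size_map ?st // => k ltk.
by rewrite (nth_map y) // index_uniq.
Qed.

Lemma set2_eq (T : finType) (x y z t : T) :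
  ([set x; y] == [set z; t]) = (x == z) && (y == t) || (x == t) && (y == z).
Proof.
apply/eqP/orP=> [E | [] /andP[/eqP-> /eqP->] //]; last by rewrite setUC.
have : x \in [set z; t] by rewrite -E set21.
have : y \in [set z; t] by rewrite -E set22.
have : z \in [set x; y] by rewrite E set21.
have : t \in [set x; y] by rewrite E set22.
by do 4![case/set2P=> ?]; subst; rewrite ?eqxx; auto.
Qed.

Lemma set_seq_eq_mem (U : finType) (s t : seq U) :
  s =i t -> [set:: s] = [set:: t].
Proof. by move=> st; apply/setP=> x; rewrite !inE st. Qed.

(** * Matchable vertex sets *)

Definition matchable (U : finType) (G : graph U) (A : {set U}) : Prop :=
  exists M : {set {set U}}, [/\ M \subset eset G, trivIset M & cover M = A].

(** The functional form of a perfect matching of [A]: it makes restriction to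
    closed subsets, disjoint unions and alternation between two matchings easy
    to express. *)
Definition partner_map (U : finType) (G : graph U) (A : {set U}) (f : U -> U) :=
  {in A, forall x, [/\ f x \in A, f (f x) = x & adj G x (f x)]}.

Lemma adj_sym (U : finType) (G : graph U) : symmetric (adj G).
Proof. by move=> x y; rewrite /adj setUC. Qed.

Lemma adj_neq (U : finType) (G : graph U) x y : adj G x y -> x != y.
Proof. by move/eset_edge/andP=> [+ _]; rewrite cards2; case: (x != y). Qed.

Lemma adj_vset (U : finType) (G : graph U) x y :
  adj G x y -> (x \in vset G) && (y \in vset G).
Proof. by move/eset_edge/andP=> [_]; rewrite subUset !sub1set. Qed.

Lemma matchableP (U : finType) (G : graph U) (A : {set U}) :
  matchable G A <-> exists f, partner_map G A f.
Proof.
split=> [[M [MG tM <-]] | [f fP]].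
  have /fin_all_exists[f fM] x : exists y, x \in cover M -> [set x; y] \in M.
    have [/bigcupP[B BM xB] | _] := boolP (x \in cover M); last by exists x.
    have /eset_edge/andP[/cards2P[a [b [_ defB]]] _] := subsetP MG _ BM.
    move: xB; rewrite defB in BM *; case/set2P=> ->; first by exists b.
    by exists a; rewrite setUC.
  exists f => x xM; have xfM := fM x xM.
  have fxM : f x \in cover M.
    by apply/bigcupP; exists [set x; f x]; rewrite // set22.
  have ffxM := fM _ fxM; have xfx := subsetP MG _ xfM; split=> //.
  have : x \in [set f x; f (f x)].
    by rewrite -(def_pblock tM ffxM (set21 _ _)) (def_pblock tM xfM (set22 _ _)) set21.
  by case/set2P=> // eqx; move: (adj_neq xfx); rewrite -eqx eqxx.
exists [set [set x; f x] | x in A]; split.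
- by apply/subsetP=> _ /imsetP[x xA ->]; have [_ _] := fP x xA.
- apply/trivIsetP=> _ _ /imsetP[x xA ->] /imsetP[y yA ->]; apply: contraR.
  have [_ ffx _] := fP x xA; have [_ ffy _] := fP y yA.
  case/pred0Pn=> z /andP[/set2P[] -> /set2P[] zE]; last 1 first.
  - by rewrite -ffx zE ffy.
  - by rewrite zE.
  - by rewrite zE ffy setUC.
  - by rewrite -zE ffx setUC.
apply/setP=> x; apply/bigcupP/idP=> [[_ /imsetP[y yA ->]] | xA].
  by have [fyA _ _] := fP y yA; case/set2P=> ->.
by exists [set x; f x]; rewrite ?set21 //; apply: imset_f.
Qed.

Lemma matchable_closed (U : finType) (G : graph U) (A B : {set U}) f :
  partner_map G A f -> B \subset A -> {in B, forall x, f x \in B} ->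
  matchable G B.
Proof.
move=> fP /subsetP BA fB; apply/matchableP; exists f => x xB.
by have [_ ? ?] := fP x (BA x xB); split; rewrite ?fB.
Qed.

Lemma matchable_even (U : finType) (G : graph U) (A : {set U}) :
  matchable G A -> ~~ odd #|A|.
Proof.
case=> M [/subsetP MG /eqP tM <-]; rewrite -tM.
rewrite (eq_bigr (fun=> 2)) => [|B /MG/eset_edge/andP[/eqP //]].
by rewrite sum_nat_const oddM andbF.
Qed.

Lemma matchable0 (U : finType) (G : graph U) : matchable G set0.
Proof. by apply/matchableP; exists id => x; rewrite inE. Qed.

Lemma matchable2 (U : finType) (G : graph U) x y :
  adj G x y -> matchable G [set x; y].
Proof.
move=> xy; have nxy := adj_neq xy.
apply/matchableP; exists (fun z => if z == x then y else x) => z.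
case/set2P=> ->; first by rewrite eqxx eq_sym (negPf nxy) set22.
by rewrite eq_sym (negPf nxy) eqxx set21 adj_sym.
Qed.

Lemma matchableU (U : finType) (G : graph U) (A B : {set U}) :
  matchable G A -> matchable G B -> [disjoint A & B] -> matchable G (A :|: B).
Proof.
move=> /matchableP[f fP] /matchableP[g gP] dAB.
apply/matchableP; exists (fun x => if x \in A then f x else g x) => x.
rewrite !inE; case: ifP => [xA _ | /= _ xB].
  by have [-> -> ->] := fP x xA.
by have [gB -> ->] := gP x xB; rewrite (disjointFl dAB gB) gB orbT.
Qed.

(** Take every second edge, starting with the first. *)
Lemma matchable_path (U : finType) (G : graph U) s :
  uniq s -> ~~ odd (size s) -> sorted (adj G) s -> matchable G [set:: s].
Proof.
have [n] := ubnP (size s); elim: n s => // n IH [|x [|y s]] //.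
  by rewrite set_nil => _ _ _ _; apply: matchable0.
rewrite /= !ltnS negbK !inE negb_or => /ltnW sn /and3P[/andP[_ xs] ys us] os.
case/andP=> xy /path_sorted ss; rewrite !set_cons setUA.
apply: matchableU (matchable2 xy) (IH s _ us os ss) _; first by [].
by rewrite disjoints_subset subUset !sub1set !inE xs ys.
Qed.

Lemma matchable_del_vertices (U : finType) (G : graph U) (A : {set U}) :
  has_perfect_matching (del_vertices G A) <-> matchable G (vset G :\: A).
Proof.
split=> -[M [MG tM defM]]; exists M; split=> //.
- by apply/subsetP=> e /(subsetP MG); rewrite inE => /andP[].
- by rewrite defM setDE.
- apply/subsetP=> e eM; rewrite inE (subsetP MG) //=.
  apply: (@subset_trans _ _ (mem (cover M))); first exact: (bigcup_max e).
  by rewrite defM setDE subsetIr.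
- by rewrite defM setDE.
Qed.

(** * Alternating paths *)

(** In the graph formed by the [m]-edges and the [n]-edges, with the vertices of
    [O] not incident to any [n]-edge, a path without repetition is forced to
    alternate.  Started with an [m]-edge and ended in [O], it cannot meet [O]
    earlier, since a vertex of [O] has degree 1; so its inner vertices come in
    consecutive pairs matched by [n].  The last hypothesis before the conclusion
    says that the path does not start with an [n]-edge, which is what the
    induction by two steps needs. *)
Lemma alternating_path (U : finType) (G : graph U) (O : {set U}) m n x s :
  partner_map G (vset G) m -> partner_map G (vset G :\: O) n -> x \in vset G ->
  path (fun x y => (y == m x) || (x \notin O) && (y == n x)) x s ->
  uniq (x :: s) -> s != [::] -> last x s \in O -> (x \in O) || (n x \notin s) ->
  exists i, [/\ s = rcons i (last x s), ~~ odd (size i),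
    path (adj G) x s & {in i, forall y, y \in vset G :\: O /\ n y \in i}].
Proof.
move=> mP nP; have [k] := ubnP (size s).
elim: k s x => // k IH [|y s] // x; rewrite ltnS => sk xV.
case/andP=> xy ys uxys _ lO xn.
have {xy xn} def_y : y = m x.
  case/predU1P: xy => // /andP[xO /eqP yE].
  by move: xn; rewrite (negPf xO) yE mem_head.
have [yV my xy] := mP x xV; rewrite -def_y in yV my xy.
have [yO | yO] := boolP (y \in O).
  case: s => [|z s] in sk ys uxys lO *; first by exists [::]; rewrite /= xy.
  move: ys; rewrite /= yO my orbF => /andP[/eqP zx _].
  by move: uxys; rewrite /= zx !inE eqxx !orbT.
case: s => [|z s] in sk ys uxys lO *; first by rewrite /= (negPf yO) in lO.
move: ys; rewrite /= yO my => /andP[/predU1P[zx | /eqP zE] zs].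
  by move: uxys; rewrite /= zx !inE eqxx !orbT.
have yA : y \in vset G :\: O by rewrite inE yO.
have [zA ny yz] := nP y yA; rewrite -zE in zA ny yz.
have [zO zV] := setDP zA.
have s0 : s != [::] by case: (s) lO => //=; rewrite (negPf zV).
have [i [defs oi pzs iP]] : exists i, [/\ s = rcons i (last z s), ~~ odd (size i),
    path (adj G) z s & {in i, forall y, y \in vset G :\: O /\ n y \in i}].
  apply: IH => //; first exact: ltnW.
    by case/and3P: uxys.
  by case/and3P: uxys => _ yzs _; apply/orP; right; rewrite ny;
     apply: contra yzs => ys; rewrite inE ys orbT.
exists [:: y, z & i]; split; rewrite /= ?negbK -?defs //.
  by rewrite xy yz.
move=> u; rewrite !inE => /or3P[/eqP->|/eqP->|ui].
- by rewrite -zE yO yV !eqxx orbT.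
- by rewrite ny zO zV eqxx.
by have [+ ->] := iP u ui; rewrite inE !orbT.
Qed.

(** If no alternating path left [C] for the rest of [O], then the set [K] reached
    from [C] would meet [O] in [C] only.  Both [K] (by [m]) and [K] minus [C]
    (by [n]) would be matchable, hence even, and so would be [C]. *)
Lemma alternating_path_exists (U : finType) (G : graph U) (C O : {set U}) :
  C \subset O -> O \subset vset G -> odd #|C| ->
  matchable G (vset G) -> matchable G (vset G :\: O) ->
  exists v w i, [/\ v \in C, w \in O :\: C,
     uniq (v :: rcons i w) /\ {subset i <= vset G :\: O}, ~~ odd (size i) &
     path (adj G) v (rcons i w) /\ matchable G (vset G :\: O :\: [set:: i])].
Proof.
move=> /subsetP CO /subsetP OV oC /matchableP[m mP] /matchableP[n nP].
pose e x y := (y == m x) || (x \notin O) && (y == n x).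
have [/existsP[v /andP[vC /existsP[w /andP[wO /connectP[p0 ]]]]] | noP] :=
  boolP [exists v in C, exists w in O :\: C, connect e v w].
  case/shortenP=> p vp up _ defw.
  have vV := OV v (CO v vC).
  have [|||i [defp oi pp iP]] := alternating_path mP nP vV vp up.
  - by apply: contraTneq wO => p0'; rewrite defw p0' /= inE vC.
  - by rewrite -defw; case/setDP: wO.
  - by rewrite CO.
  rewrite -defw in defp; exists v, w, i; rewrite -defp.
  split=> //; split=> //; first by move=> y /iP[].
  apply: (matchable_closed nP); first exact: subsetDl.
  move=> x /setDP[xA xi]; have [nxA nnx _] := nP x xA.
  rewrite in_setD nxA andbT; apply: contra xi; rewrite !inE => nxi.
  by have [_] := iP _ nxi; rewrite nnx.
pose K := [set y in vset G | [exists x in C, connect e x y]].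
have KO y : y \in K -> y \in O -> y \in C.
  rewrite inE => /andP[yV /existsP[x /andP[xC xy]]] yO; apply: contraNT noP => yC.
  by apply/existsP; exists x; rewrite xC; apply/existsP; exists y; rewrite inE yC yO.
have CK : C \subset K.
  apply/subsetP=> x xC; rewrite inE OV ?CO //=.
  by apply/existsP; exists x; rewrite xC connect0.
have Kstep y z : y \in K -> z \in vset G -> e y z -> z \in K.
  rewrite inE => /andP[yV /existsP[x /andP[xC xy]]] zV yz; rewrite inE zV.
  by apply/existsP; exists x; rewrite xC (connect_trans xy (connect1 yz)).
have /matchable_even Keven : matchable G K.
  apply: (matchable_closed mP) => [|y yK]; first by apply/subsetP=> y /setIdP[].
  have [|myV _ _] := mP y; first by case/setIdP: yK.
  by apply: Kstep yK myV _; rewrite /e eqxx.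
have /matchable_even : matchable G (K :\: C).
  have KA y : y \in K :\: C -> y \in vset G :\: O.
    case/setDP=> yK; have /setIdP[yV _] := yK.
    by rewrite inE yV andbT; apply/contra/KO.
  apply: (matchable_closed nP) => [|y yKC]; first exact/subsetP.
  have yA := KA y yKC; have [/setDP[nyV nyO] _ _] := nP y yA.
  have /setDP[yK _] := yKC; have /setDP[_ yO] := yA.
  rewrite inE (contra (CO _) nyO) (Kstep y) //.
  by rewrite /e yO eqxx orbT.
move: Keven; rewrite -(cardsID C K) (setIidPr CK) oddD oC /=.
by case: (odd _).
Qed.

(** * Covers, and the reduction to two odd cycles *)

Definition odd_cycle (U : finType) (G : graph U) (c : seq U) : bool :=
  [&& uniq c, 2 < size c, odd (size c) & cycle (adj G) c].

(** The independent edges of a cover enter only through the vertex set that they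
    match.  The set [S] is a parameter so that a cover can be built one component
    at a time. *)
Definition covers (U : finType) (G : graph U) (S : {set U}) (cs : seq (seq U)) :=
  [/\ all (odd_cycle G) cs, uniq (flatten cs), {subset flatten cs <= S}
    & matchable G (S :\: [set:: flatten cs])].

(** The cycles are written from the vertices [v] and [w] where the path leaves
    them; [i] lists the inner vertices of the path. *)
Definition dumbbell (U : finType) (G : graph U) v s1 i w s2 : Prop :=
  [/\ odd_cycle G (v :: s1), odd_cycle G (w :: s2), path (adj G) v (rcons i w),
      ~~ odd (size i) & uniq ((v :: s1) ++ i ++ (w :: s2))].

Lemma covers_nil (U : finType) (G : graph U) (S : {set U}) :
  matchable G S -> covers G S [::].
Proof. by split; rewrite //= set_nil setD0. Qed.

Lemma covers_cons (U : finType) (G : graph U) (S : {set U}) c cs :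
  odd_cycle G c -> {subset c <= S} -> covers G (S :\: [set:: c]) cs ->
  covers G S (c :: cs).
Proof.
move=> oc cS [ocs ucs csS mS]; split; rewrite /= ?oc //.
- rewrite cat_uniq ucs andbT; case/and4P: (oc) => -> _ _ _ /=.
  by apply/hasPn=> x /csS; rewrite !inE => /andP[].
- by move=> x; rewrite mem_cat => /orP[/cS | /csS/setDP[]].
congr (matchable G _): mS; apply/setP=> x; rewrite !inE mem_cat negb_or.
by rewrite andbCA andbA.
Qed.

Lemma odd_cycle_rot (U : finType) (G : graph U) k c :
  odd_cycle G (rot k c) = odd_cycle G c.
Proof. by rewrite /odd_cycle rot_uniq size_rot rot_cycle. Qed.

Lemma odd_cycle_vset (U : finType) (G : graph U) c :
  odd_cycle G c -> {subset c <= vset G}.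
Proof.
by case/and4P=> _ _ _ cc x xc; case/andP: (adj_vset (next_cycle cc xc)).
Qed.

Lemma matchable_odd_cycleD1 (U : finType) (G : graph U) v s :
  odd_cycle G (v :: s) -> matchable G [set:: s].
Proof.
case/and4P=> /= /andP[_ us] _ os; rewrite rcons_path => /andP[/path_sorted ss _].
exact: matchable_path.
Qed.

Lemma matchable_cat (U : finType) (G : graph U) s t :
  uniq (s ++ t) -> matchable G [set:: s] -> matchable G [set:: t] ->
  matchable G [set:: s ++ t].
Proof.
rewrite cat_uniq => /and3P[_ /hasPn st _] ms mt.
have -> : [set:: s ++ t] = [set:: s] :|: [set:: t].
  by apply/setP=> x; rewrite !inE mem_cat.
apply: matchableU => //; rewrite disjoint_sym disjoints_subset.
by apply/subsetP=> x; rewrite !inE => /st.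
Qed.

(** The path takes both of its ends, which leaves of each odd cycle a path with
    evenly many vertices. *)
Lemma dumbbell_matchable (U : finType) (G : graph U) v s1 i w s2 :
  dumbbell G v s1 i w s2 -> matchable G [set:: (v :: s1) ++ i ++ (w :: s2)].
Proof.
case=> oc1 oc2 pth oi uD.
have pD : perm_eq ((v :: s1) ++ i ++ w :: s2) ((v :: rcons i w) ++ s1 ++ s2).
  by rewrite -cat_rcons /= perm_cons perm_catCA.
rewrite (set_seq_eq_mem (perm_mem pD)); rewrite (perm_uniq pD) in uD.
have /and3P[up _ us] : [&& uniq (v :: rcons i w),
    ~~ has (mem (v :: rcons i w)) (s1 ++ s2) & uniq (s1 ++ s2)].
  by rewrite -cat_uniq.
apply: matchable_cat => //.
  by apply: matchable_path; rewrite //= size_rcons /= negbK.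
by apply: matchable_cat => //; apply: matchable_odd_cycleD1; eassumption.
Qed.

(** Induction on the number of odd cycles: the dumbbell around two of them either
    contains all the odd cycles, or is matchable and frees the cover from both. *)
Lemma covers_dumbbell (U : finType) (G : graph U) cs :
  matchable G (vset G) -> covers G (vset G) cs -> cs != [::] ->
  exists v s1 i w s2, dumbbell G v s1 i w s2 /\
    matchable G (vset G :\: [set:: (v :: s1) ++ i ++ (w :: s2)]).
Proof.
move=> mV; have [n] := ubnP (size cs).
elim: n cs => // n IH [|c1 cs1] //; rewrite ltnS /= => sn.
case=> /= /andP[oc1 ocs] ucs csV mcs _.
have uc1 : uniq c1 by case/and4P: oc1.
have [||| v [w [i [vc1 wO [upi iA] oi [pth mi]]]]] :=
  @alternating_path_exists U G [set:: c1] [set:: c1 ++ flatten cs1] _ _ _ mV mcs.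
- by apply/subsetP=> x; rewrite !inE mem_cat => ->.
- by apply/subsetP=> x; rewrite inE => /csV.
- by rewrite cardsE (card_uniqP uc1); case/and4P: oc1.
rewrite inE in vc1; have wcs1 : w \in flatten cs1.
  by move: wO; rewrite !inE mem_cat => /andP[/negPf->].
have [c2 c2cs1 wc2] := flattenP wcs1.
have [k1 s1 def1] := rot_to vc1; have [k2 s2 def2] := rot_to wc2.
have oc2 := allP ocs _ c2cs1.
have pcs : perm_eq (c1 ++ flatten cs1)
    ((v :: s1) ++ (w :: s2) ++ flatten (rem c2 cs1)).
  rewrite -def1 -def2; apply: perm_cat; first by rewrite perm_sym perm_rot.
  rewrite (perm_trans (perm_flatten (perm_to_rem c2cs1))) //=.
  by rewrite perm_cat2r perm_sym perm_rot.
have ui : uniq i by move: upi; rewrite /= rcons_uniq => /and3P[].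
set D := (v :: s1) ++ i ++ w :: s2.
(* All disjointness statements and set equalities below come from the fact that the
   vertices of [D] and of the remaining cycles are those of [i] and of all the
   cycles, and that [i] lies outside the cycles. *)
have pD : perm_eq (D ++ flatten (rem c2 cs1)) (i ++ c1 ++ flatten cs1).
  rewrite perm_sym; have := pcs; rewrite -(perm_cat2l i) => /perm_trans-> //.
  by rewrite perm_catCA /D -!catA.
have uD : uniq (D ++ flatten (rem c2 cs1)).
  rewrite (perm_uniq pD) cat_uniq ui ucs andbT /=; apply/hasPn=> x xcs.
  by apply/negP=> /iA; rewrite !inE xcs.
have dD : dumbbell G v s1 i w s2.
  split; rewrite -?def1 -?def2 ?odd_cycle_rot ?def1 ?def2 //.
  by move: uD; rewrite cat_uniq => /and3P[].
have [cs'0 | cs'n0] := eqVneq (rem c2 cs1) [::].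
  exists v, s1, i, w, s2; rewrite -/D; split=> //.
  congr (matchable G _): mi.
  rewrite cs'0 cats0 in pD; apply/setP=> x.
  by rewrite !(in_setD, in_set) (perm_mem pD) [in RHS]mem_cat negb_or andbA.
have iV : {subset i <= vset G} by move=> x /iA/setDP[].
apply: (IH (rem c2 cs1)) => //.
  rewrite size_rem //; apply: leq_trans sn; rewrite ltnS.
  by rewrite -subn1 leq_subr.
have subV : {subset D ++ flatten (rem c2 cs1) <= vset G}.
  by move=> x; rewrite (perm_mem pD) mem_cat => /orP[/iV | /csV].
split.
- by apply/allP=> c /mem_rem; apply: (allP ocs).
- by move: uD; rewrite cat_uniq => /and3P[].
- by move=> x xc; rewrite subV // mem_cat xc orbT.
have -> : vset G :\: [set:: flatten (rem c2 cs1)] =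
    [set:: D] :|: (vset G :\: [set:: c1 ++ flatten cs1] :\: [set:: i]).
  apply/setP=> x; rewrite !(in_setU, in_setD, in_set).
  have := perm_mem pD x; rewrite [in LHS]mem_cat [in RHS]mem_cat.
  move: uD; rewrite cat_uniq => /and3P[_ /hasPn /(_ x) /= dis _].
  have := subV x; rewrite mem_cat.
  case: (x \in i); case: (x \in c1 ++ _); case: (x \in D) dis;
    case: (x \in flatten (rem _ _)) => //= h1 h2 _; rewrite ?h2 //.
apply: matchableU => //; first exact: dumbbell_matchable.
rewrite disjoints_subset; apply/subsetP=> x; rewrite !(in_setC, in_setD, in_set) => xD.
have := perm_mem pD x; rewrite mem_cat xD mem_cat => /esym/orP[->|->] //=.
by rewrite andbF.
Qed.

(** * From spanning subgraphs to lists of odd cycles and back *)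

Definition cycle_edges (U : finType) (c : seq U) : {set {set U}} :=
  [set [set x; next c x] | x in c].

Lemma connect_adj_sym (U : finType) (G : graph U) : connect_sym (adj G).
Proof. exact/sym_connect_sym/adj_sym. Qed.

Lemma connect_vset (U : finType) (H : graph U) x y :
  x \in vset H -> connect (adj H) x y -> y \in vset H.
Proof.
move=> xH /connectP[p xp ->]; elim: p x xH xp => //= z p IH x _ /andP[xz].
by case/andP: (adj_vset xz) => _; apply: IH.
Qed.

Lemma vset_component (U : finType) (H : graph U) x :
  x \in vset H -> vset (component H x) = [set y | connect (adj H) x y].
Proof. by move=> xH; apply/setIidPr/subsetP=> y; rewrite inE; apply: connect_vset. Qed.

Lemma adj_component (U : finType) (H : graph U) x y z :
  adj (component H x) y z -> adj H y z.
Proof. by rewrite /adj inE => /andP[]. Qed.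

Lemma component_odd_cycle (U : finType) (G H : graph U) C :
  eset H \subset eset G -> is_component C H -> is_odd_cycle C ->
  exists2 c, odd_cycle G c & vset C = [set:: c].
Proof.
move=> /subsetP HG [x xH ->] [c [uc sc oc Vc Ec]]; exists c => //.
rewrite /odd_cycle uc sc oc cycle_from_next // => y yc.
by apply/HG/(@adj_component _ _ x); rewrite /adj Ec; apply: imset_f.
Qed.

(** Peel off one component of [H] at a time; [S] is a union of components. *)
Lemma covers_components (U : finType) (G H : graph U) (S : {set U}) :
  eset H \subset eset G ->
  (forall C, is_component C H -> is_single_edge C \/ is_odd_cycle C) ->
  S \subset vset H -> (forall x y, adj H x y -> x \in S -> y \in S) ->
  exists cs, covers G S cs.
Proof.
move=> HG comps; have [n] := ubnP #|S|; elim: n S => // n IH S.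
rewrite ltnS => Sn SH Sclosed.
have [-> | [x xS]] := set_0Vmem S.
  by exists [::]; apply/covers_nil/matchable0.
have xH := subsetP SH x xS; pose B := [set y | connect (adj H) x y].
have xB : x \in B by rewrite inE connect0.
have BS : B \subset S.
  apply/subsetP=> y; rewrite inE => xy.
  by rewrite -(closed_connect (intro_closed (connect_adj_sym H) Sclosed) xy).
have [||| cs csP] := IH (S :\: B).
- by apply: leq_trans Sn; rewrite [ltnRHS](cardsD1 x) xS ltnS subset_leq_card //
     setDS // sub1set.
- exact: subset_trans (subsetDl _ _) SH.
- move=> y z yz; rewrite !inE => /andP[xy yS]; rewrite (Sclosed _ _ yz yS) andbT.
  by apply: contra xy => /connect_trans; apply; rewrite connect1 // adj_sym.
have compB : is_component (component H x) H by exists x.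
have defB : vset (component H x) = B by apply: vset_component.
case: (comps _ compB) => [[a [b [nab Vab Eab]]] | /(component_odd_cycle HG compB)].
  have mB : matchable G B.
    rewrite -defB Vab; apply/matchable2/(subsetP HG)/(@adj_component _ _ x).
    by rewrite /adj Eab set11.
  case: csP => ocs ucs csS mcs; exists cs; split=> //; first by move=> y /csS/setDP[].
  have -> : S :\: [set:: flatten cs] = B :|: (S :\: B :\: [set:: flatten cs]).
    apply/setP=> y; rewrite !(in_setU, in_setD, in_set).
    have [/idP yB | //] := boolP (connect (adj H) x y).
    rewrite (subsetP BS) ?inE // andbT; apply/negP=> /csS.
    by rewrite !inE yB.
  apply: matchableU => //; rewrite disjoints_subset; apply/subsetP=> y yB.
  by rewrite !(in_setC, in_setD) yB andbF.
case=> c oc; rewrite defB => defBc; exists (c :: cs).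
apply: covers_cons => //; last by rewrite -defBc.
by move=> y yc; apply: (subsetP BS); rewrite defBc inE.
Qed.

(** The odd component that is known to exist is put into the list by hand, so
    that the list is not empty. *)
Lemma spanning_covers (U : finType) (G H : graph U) :
  spanning_subgraph H G ->
  (forall C, is_component C H -> is_single_edge C \/ is_odd_cycle C) ->
  (exists C, is_component C H /\ is_odd_cycle C) ->
  exists2 cs, cs != [::] & covers G (vset G) cs.
Proof.
move=> [[_ HG] VH] comps [C [CH oC]].
have [c oc defC] := component_odd_cycle HG CH oC.
case: CH defC => x xH ->; rewrite vset_component // => defC.
have cV : {subset c <= vset G}.
  by move=> y yc; apply: odd_cycle_vset oc _ yc.
have [||cs csP] := @covers_components U G H (vset G :\: [set:: c]) HG comps.
- by rewrite VH subsetDl.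
- move=> y z yz; rewrite -defC !inE -VH => /andP[xy yV].
  case/andP: (adj_vset yz) => _ ->; rewrite andbT.
  by apply: contra xy => /connect_trans; apply; rewrite connect1 // adj_sym.
by exists (c :: cs) => //; apply: covers_cons.
Qed.

(** A connected set [B] that no edge leaves is a component, and the edges [EB]
    that meet it are the edges of that component. *)
Lemma component_block (U : finType) (H : graph U) (B : {set U}) (EB : {set {set U}}) x :
  x \in B -> B \subset vset H -> {in B, forall y, connect (adj H) x y} ->
  EB \subset eset H -> (forall e, e \in EB -> e \subset B) ->
  (forall e y, e \in eset H -> y \in e -> y \in B -> e \in EB) ->
  vset (component H x) = B /\ eset (component H x) = EB.
Proof.
move=> xB /subsetP BH Bx /subsetP EBH EBB Bclosed.
have defB : [set y | connect (adj H) x y] = B.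
  apply/setP=> y; rewrite inE; apply/idP/idP=> [xy | /Bx //].
  rewrite -(closed_connect (intro_closed (connect_adj_sym H) _) xy) // => a b ab aB.
  by apply: (subsetP (EBB _ (Bclosed _ a ab _ aB))); rewrite (set21, set22).
rewrite vset_component ?BH // defB; split=> //.
apply/setP=> e; rewrite /= inE defB; apply/andP/idP=> [[eH eB] | eE].
  have /andP[/cards2P[a [b [_ defe]]] _] := eset_edge eH.
  have ae : a \in e by rewrite defe set21.
  exact: (Bclosed _ _ eH ae (subsetP eB _ ae)).
by rewrite EBH // EBB.
Qed.

Lemma cycle_edges_sub (U : finType) (c : seq U) e :
  e \in cycle_edges c -> {subset e <= c}.
Proof.
by case/imsetP=> x xc -> y; case/set2P=> -> //; rewrite mem_next.
Qed.

(** The subgraph [H] consists of the edges of a matching of the rest and the edges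
    of the listed cycles.  These blocks have pairwise disjoint vertex sets, so
    they are the components of [H]. *)
Lemma covers_spanning (U : finType) (G : graph U) cs :
  cs != [::] -> covers G (vset G) cs ->
  exists H : graph U,
     [/\ spanning_subgraph H G,
         forall C, is_component C H -> is_single_edge C \/ is_odd_cycle C
       & exists C, is_component C H /\ is_odd_cycle C].
Proof.
move=> cs0 [/allP ocs ucs csV [M [MG tM defM]]].
pose E := M :|: \bigcup_(c <- cs) cycle_edges c.
have Ecs e : reflect (exists2 c, c \in cs & e \in cycle_edges c)
                     (e \in \bigcup_(c <- cs) cycle_edges c).
  rewrite big_tnth; apply: (iffP bigcupP) => [[i _ ei] | [c /seq_tnthP[i ->] ei]].
    by exists (tnth (in_tuple cs) i); rewrite // mem_tnth.
  by exists i.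
have EG : E \subset eset G.
  rewrite subUset MG; apply/subsetP=> e /Ecs[c /ocs/and4P[_ _ _ cc]].
  by case/imsetP=> x xc ->; exact: (next_cycle cc xc).
pose H := @Graph U (vset G) E (fun e eE => eset_edge (subsetP EG e eE)).
have adjM x y : [set x; y] \in M -> adj H x y by rewrite /adj /= inE => ->.
have adjc c : c \in cs -> cycle (adj H) c.
  move=> ccs; apply: cycle_from_next; first by case/and4P: (ocs c ccs).
  move=> x xc; rewrite /adj inE; apply/orP; right; apply/Ecs; exists c => //.
  exact: imset_f.
have Mcs e x c : e \in M -> x \in e -> c \in cs -> x \in c -> False.
  move=> eM xe ccs xc; have : x \in cover M by apply/bigcupP; exists e.
  by rewrite defM !inE => /andP[/negP[]]; apply/flattenP; exists c.
have oddH c x : c \in cs -> x \in c -> is_odd_cycle (component H x).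
  move=> ccs xc; have [||||||VC EC] := @component_block U H [set:: c] (cycle_edges c) x.
  - by rewrite inE.
  - by apply/subsetP=> y; rewrite inE => yc; apply: odd_cycle_vset (ocs c ccs) _ yc.
  - by move=> y; rewrite inE; apply: connect_cycle (adjc c ccs) _ _ xc.
  - by apply/subsetP=> e ec; rewrite inE; apply/orP; right; apply/Ecs; exists c.
  - by move=> e ec; apply/subsetP=> y; rewrite inE; apply: (cycle_edges_sub ec).
  - move=> e y /setUP[eM ye | /Ecs[d dcs ed ye]]; rewrite inE => yc.
      by case: (Mcs e y c).
    by rewrite (uniq_flatten_mem ucs ccs dcs yc (cycle_edges_sub ed ye)).
  by exists c; rewrite VC EC; case/and4P: (ocs c ccs).
exists H; split.
- by split; first split; rewrite /=.
- move=> _ [x xV ->]; have [/flattenP[c ccs xc] | xcs] := boolP (x \in flatten cs).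
    by right; apply: oddH ccs xc.
  have /bigcupP[e eM xe] : x \in cover M by rewrite defM !inE xcs.
  left; have /eset_edge/andP[/cards2P[a [b [nab defe]]] eV] := subsetP MG e eM.
  have [||||||VC EC] := @component_block U H e [set e] x; last first.
  + by exists a, b; rewrite VC EC defe.
  + move=> d y /setUP[dM yd ye | /Ecs[c ccs dc yd ye]].
      by rewrite inE -(def_pblock tM dM yd) (def_pblock tM eM ye).
    by case: (Mcs e y c) => //; apply: cycle_edges_sub dc _ yd.
  + by move=> d /set1P->.
  + by rewrite sub1set inE eM.
  + move=> y; rewrite defe in eM xe *; have ab := adjM _ _ eM.
    have ba : adj H b a by rewrite adj_sym.
    by case/set2P: xe => -> /set2P[] ->; rewrite (connect0, connect1).
  + exact: eV.
  + exact: xe.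
have [c ccs] : exists c, c \in cs.
  by case: (cs) cs0 => // c cs' _; exists c; rewrite mem_head.
have [x xc] : exists x, x \in c.
  by case: c ccs => [/ocs | x c _] //; exists x; rewrite mem_head.
exists (component H x); split; last exact: oddH ccs xc.
by exists x; rewrite //= csV //; apply/flattenP; exists c.
Qed.

(** * Subdivisions as families of internally disjoint paths *)

Lemma mem_pairmap_edge (U : finType) (G : graph U) x s e :
  path (adj G) x s -> e \in pairmap (fun y z => [set y; z]) x s ->
  e \in eset G /\ {subset e <= x :: s}.
Proof.
elim: s x => //= y s IH x /andP[xy ys]; rewrite inE => /predU1P[->|/IH[//|eG es]].
  by split=> // z /set2P[]->; rewrite !inE eqxx ?orbT.
by split=> // z /es; rewrite [in X in _ -> X]inE orbC => ->.
Qed.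

Lemma path_pairmap (U : finType) (P : graph U) x s :
  {subset pairmap (fun y z => [set y; z]) x s <= eset P} -> path (adj P) x s.
Proof.
elim: s x => //= y s IH x sub; rewrite IH ?andbT => [|e es].
  by rewrite /adj sub ?mem_head.
by rewrite sub // inE es orbT.
Qed.

Lemma odd_path_graph (U : finType) (G : graph U) x s y :
  path (adj G) x (rcons s y) -> uniq (x :: rcons s y) -> ~~ odd (size s) ->
  exists P, [/\ is_odd_path [set x; y] P, vset P = [set:: x :: rcons s y]
              & eset P \subset eset G].
Proof.
move=> pth us os; pose es := pairmap (fun y z => [set y; z]) x (rcons s y).
have Pedge e : e \in [set:: es] -> (#|e| == 2) && (e \subset [set:: x :: rcons s y]).
  rewrite inE => /(mem_pairmap_edge pth)[/eset_edge/andP[-> _] sub] /=.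
  by apply/subsetP=> z; rewrite inE; apply: sub.
exists (Graph Pedge); split=> //.
  by exists x, (rcons s y); rewrite last_rcons size_rcons.
by apply/subsetP=> e; rewrite inE => /(mem_pairmap_edge pth)[].
Qed.

(** The definition of an odd path fixes its two ends as a set; reversing the path
    if necessary makes it run from [x] to [y]. *)
Lemma odd_path_between (U : finType) (P : graph U) x y :
  is_odd_path [set x; y] P -> x != y ->
  exists s, [/\ uniq (x :: rcons s y), ~~ odd (size s),
    path (adj P) x (rcons s y) & vset P = [set:: x :: rcons s y]].
Proof.
case=> x0 [s0 [us0 os0 exy VP EP]] nxy.
case/lastP: s0 => // s z in us0 os0 exy VP EP *.
have {EP} pth : path (adj P) x0 (rcons s z).
  by apply: path_pairmap => e; rewrite EP inE.
rewrite last_rcons in exy; rewrite size_rcons /= in os0.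
have : y \in [set x0; z] by rewrite -exy set22.
have : x \in [set x0; z] by rewrite -exy set21.
case/set2P=> xE; case/set2P=> yE; subst x y; rewrite ?eqxx // in nxy *.
  by exists s.
have rE : z :: rcons (rev s) x0 = rev (x0 :: rcons s z).
  by rewrite rev_cons rev_rcons.
exists (rev s); rewrite rE rev_uniq size_rev; split=> //.
  have := rev_path (adj P) x0 (rcons s z).
  rewrite last_rcons belast_rcons rev_cons => ->.
  by rewrite (eq_path (e' := adj P)) // => u v; rewrite adj_sym.
by rewrite VP; apply: set_seq_eq_mem => u; rewrite mem_rev.
Qed.

Definition arc_edge (W : finType) (a : W * W) : {set W} := [set a.1; a.2].

(** An enumeration of [F] with a chosen direction for each edge.  Listing the
    edges as ordered pairs lets the subdivided edges be described by sequences of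
    inner vertices, read in the chosen direction. *)
Definition oriented (W : finType) (F : graph W) (vs : seq W) (arcs : seq (W * W)) :=
  [/\ uniq vs, vset F = [set:: vs], uniq (map (@arc_edge W) arcs)
    & eset F = [set:: map (@arc_edge W) arcs]].

(** [f] places the branch vertices and [s] gives the inner vertices of the path
    that replaces each arc. *)
Definition linkage_vertices (W U : finType) (vs : seq W) (arcs : seq (W * W))
    (f : W -> U) (s : W * W -> seq U) : seq U :=
  map f vs ++ flatten (map s arcs).

(** The absence of repetition in the vertex sequence says at once that [f] is
    injective on [vs], that the paths do not repeat vertices, and that they avoid each
    other and the branch vertices in their interiors. *)
Definition linkage (W U : finType) (G : graph U) (vs : seq W) (arcs : seq (W * W))
    (f : W -> U) (s : W * W -> seq U) : Prop :=
  uniq (linkage_vertices vs arcs f s) /\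
  {in arcs, forall a,
     ~~ odd (size (s a)) && path (adj G) (f a.1) (rcons (s a) (f a.2))}.

Lemma arc_mem (W : finType) (F : graph W) vs arcs a :
  oriented F vs arcs -> a \in arcs -> [/\ a.1 \in vs, a.2 \in vs & a.1 != a.2].
Proof.
case=> _ VF _ EF aA.
have aF : adj F a.1 a.2 by rewrite /adj EF inE; apply: (map_f (@arc_edge W)).
by have := adj_vset aF; rewrite VF !inE (adj_neq aF) => /andP[-> ->].
Qed.

Lemma linkage_subdivision (W U : finType) (F : graph W) (G : graph U) vs arcs f s :
  oriented F vs arcs -> {in vs, forall u, f u \in vset G} ->
  linkage G vs arcs f s ->
  exists H, [/\ even_subdivision F H, subgraph H G
              & vset H = [set:: linkage_vertices vs arcs f s]].
Proof.
move=> oF fG [uT pthA]; have arcP := arc_mem oF; case: oF => uvs VF uA EF.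
move: (uT); rewrite cat_uniq => /and3P[uf /hasPn fs us].
have finj : {in vset F &, injective f}.
  by move=> x y; rewrite VF !inE; apply: uniq_map_inj.
have fsN a u : a \in arcs -> u \in vs -> f u \in s a -> False.
  move=> aA uvs' fua; have := map_f f uvs'; apply/negP; apply: fs.
  by apply/flattenP; exists (s a); rewrite ?map_f.
have usA a : a \in arcs -> uniq (s a).
  move=> aA; elim: (arcs) aA us => //= b l IH.
  by rewrite inE cat_uniq => /predU1P[->|/IH +] /and3P[].
have /fin_all_exists[P PP] (e : {set W}) : exists Pe : graph U, e \in eset F ->
    exists2 a, a \in arcs /\ e = arc_edge a &
      [/\ is_odd_path (f @: e) Pe, vset Pe = [set:: f a.1 :: rcons (s a) (f a.2)]
        & eset Pe \subset eset G].
  (* Off the edges of [F] the value is arbitrary. *)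
  have [|_] := boolP (e \in eset F); last by exists G.
  rewrite EF inE => /mapP[a aA ->]; have [a1 a2 na] := arcP a aA.
  have /andP[os pth] := pthA a aA.
  have upth : uniq (f a.1 :: rcons (s a) (f a.2)).
    rewrite /= rcons_uniq usA // mem_rcons inE negb_or andbT.
    rewrite -andbA; apply/and3P; split.
    - by apply: contra na => /eqP/finj->; rewrite ?VF ?inE.
    - by apply/negP; apply: fsN.
    - by apply/negP; apply: fsN.
  have [Pa [oP VP EP]] := odd_path_graph pth upth os.
  by exists Pa => _; exists a; rewrite // /arc_edge imsetU1 imset_set1.
pose VH := f @: vset F :|: \bigcup_(e in eset F) vset (P e).
pose EH := \bigcup_(e in eset F) eset (P e).
have Hedge e : e \in EH -> (#|e| == 2) && (e \subset VH).
  case/bigcupP=> d dF ed; have /andP[-> eP] := eset_edge ed.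
  apply: subset_trans eP _; apply: subset_trans (subsetUr _ _).
  exact: (bigcup_max d).
have VHE : VH = [set:: linkage_vertices vs arcs f s].
  apply/setP=> x; rewrite in_set mem_cat; apply/setUP/orP.
    case=> [/imsetP[u] | /bigcupP[e eF]].
      by rewrite VF inE => uvs' ->; left; apply: map_f.
    have [a [aA _] [_ -> _]] := PP e eF; have [a1 a2 _] := arcP a aA.
    rewrite inE in_cons mem_rcons in_cons => /or3P[/eqP->|/eqP->|xs].
    - by left; apply: map_f.
    - by left; apply: map_f.
    - by right; apply/flattenP; exists (s a); rewrite ?map_f.
  case=> [/mapP[u uvs' ->] | /flattenP[_ /mapP[a aA ->] xa]].
    by left; apply: imset_f; rewrite VF inE.
  right; apply/bigcupP; have eF : arc_edge a \in eset F by rewrite EF inE map_f.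
  exists (arc_edge a) => //; have [b [bA eab] [_ -> _]] := PP _ eF.
  rewrite (uniq_map_inj uA aA bA eab) in xa *.
  by rewrite inE in_cons mem_rcons in_cons xa !orbT.
exists (Graph Hedge); split=> //; last first.
  split=> /=.
    rewrite VHE; apply/subsetP=> x; rewrite inE mem_cat.
    case/orP=> [/mapP[u /fG + ->] // | /flattenP[_ /mapP[a aA ->] xa]].
    have /andP[_ pth] := pthA a aA; elim: (s a) (f a.1) xa pth => //= y t IH z.
    by rewrite inE => /predU1P[->|yt] /andP[zy]; [case/andP: (adj_vset zy) | apply: IH].
  by apply/bigcupsP=> e eF; have [a _ []] := PP e eF.
exists f, P; split=> // [e eF | e1 e2 e1F e2F ne].
  have [a [aA eE] [oP VP _]] := PP e eF; split=> //.
  have [a1 a2 _] := arcP a aA.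
  rewrite VP eE /arc_edge imsetU1 imset_set1.
  apply/setP=> x; rewrite !inE mem_rcons inE.
  apply/andP/orP=> [[/or3P[->|->|xs]] | [/eqP->|/eqP->]]; [by left | by right | | |].
  - by case/imsetP=> u; rewrite VF inE => uvs' xE; case: (fsN a u); rewrite -?xE.
  - by rewrite eqxx imset_f // VF inE.
  - by rewrite eqxx orbT imset_f // VF inE.
have [a [aA aE] [_ -> _]] := PP e1 e1F; have [b [bA bE] [_ -> _]] := PP e2 e2F.
have [a1 a2 _] := arcP a aA; have [b1 b2 _] := arcP b bA.
apply/subsetP=> x; rewrite !inE !mem_rcons !inE => /andP[/or3P[/eqP->|/eqP->|xa]].
- by rewrite imset_f // VF inE.
- by rewrite imset_f // VF inE.
case/or3P=> [/eqP xE|/eqP xE|xb].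
- by case: (fsN a b.1); rewrite -?xE.
- by case: (fsN a b.2); rewrite -?xE.
by case/eqP: ne; rewrite aE bE (uniq_flatten_map_mem us aA bA xa xb).
Qed.

Lemma subdivision_linkage (W U : finType) (F : graph W) (H : graph U) vs arcs :
  oriented F vs arcs -> even_subdivision F H ->
  exists f s, linkage H vs arcs f s /\ vset H = [set:: linkage_vertices vs arcs f s].
Proof.
move=> oF; have arcP := arc_mem oF; case: oF => uvs VF uA EF.
case=> f [P [finj oP disP VH EH]].
have edgeF a : a \in arcs -> arc_edge a \in eset F by move=> aA; rewrite EF inE map_f.
have /fin_all_exists[s sP] (a : W * W) : exists s, a \in arcs ->
    [/\ uniq (f a.1 :: rcons s (f a.2)), ~~ odd (size s),
      path (adj (P (arc_edge a))) (f a.1) (rcons s (f a.2))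
    & vset (P (arc_edge a)) = [set:: f a.1 :: rcons s (f a.2)]].
  have [aA | _] := boolP (a \in arcs); last by exists [::].
  have [a1 a2 na] := arcP a aA; have [oPa _] := oP _ (edgeF a aA).
  have [||s sP] := @odd_path_between U (P (arc_edge a)) (f a.1) (f a.2).
  - by move: oPa; rewrite {1}/arc_edge imsetU1 imset_set1.
  - by apply: contra na => /eqP/finj->; rewrite ?VF ?inE.
  by exists s.
have sfN a u : a \in arcs -> u \in s a -> u \in f @: vset F -> False.
  move=> aA us uf; have [+ _ _ VP] := sP a aA.
  have [_ /setP/(_ u)] := oP _ (edgeF a aA).
  rewrite VP !inE uf mem_rcons inE us !orbT /arc_edge imsetU1 imset_set1 !inE /=.
  case/esym/orP=> /eqP uE; rewrite -uE /= ?mem_rcons ?inE ?us ?orbT //=.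
  by rewrite rcons_uniq us andbF.
have sV a u : a \in arcs -> u \in s a -> u \in vset (P (arc_edge a)).
  by move=> aA us; have [_ _ _ ->] := sP a aA; rewrite !inE mem_rcons inE us !orbT.
exists f, s; split; first split.
- rewrite cat_uniq map_inj_in_uniq ?uvs => [|x y xv yv]; last first.
    by apply: finj; rewrite VF inE.
  apply/and3P; split=> //.
    apply/hasPn=> u /flattenP[_ /mapP[a aA ->] us]; apply/negP=> /mapP[x xv uE].
    by case: (sfN a u) => //; rewrite uE imset_f // VF inE.
  apply: flatten_map_uniq => [|a aA|a b u aA bA ua ub]; first exact: map_uniq uA.
    by have [/= /andP[_ +] _ _ _] := sP a aA; rewrite rcons_uniq => /andP[].
  apply: (uniq_map_inj uA) => //; apply/eqP/negPn/negP=> ne.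
  apply: (sfN a u) => //; apply: (subsetP (disP _ _ (edgeF a aA) (edgeF b bA) ne)).
  by rewrite inE !sV.
- move=> a aA; have [_ -> pth _] := sP a aA; apply: sub_path pth => x y.
  by rewrite /adj EH => xy; apply/bigcupP; exists (arc_edge a); rewrite ?edgeF.
rewrite VH; apply/setP=> u; rewrite in_set mem_cat; apply/setUP/orP.
  case=> [/imsetP[x] | /bigcupP[e]].
    by rewrite VF inE => xv ->; left; apply: map_f.
  rewrite EF inE => /mapP[a aA ->]; have [_ _ _ ->] := sP a aA.
  have [a1 a2 _] := arcP a aA.
  rewrite inE in_cons mem_rcons in_cons => /or3P[/eqP->|/eqP->|us].
  - by left; apply: map_f.
  - by left; apply: map_f.
  - by right; apply/flattenP; exists (s a); rewrite ?map_f.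
case=> [/mapP[x xv ->] | /flattenP[_ /mapP[a aA ->] us]].
  by left; rewrite imset_f // VF inE.
by right; apply/bigcupP; exists (arc_edge a); rewrite ?edgeF ?sV.
Qed.

(** * Subdivisions of two triangles joined by an edge *)

Definition corner (b : bool) (k : nat) : bool * 'I_3 := (b, inord k).

Definition corners : seq (bool * 'I_3) :=
  [seq corner b k | b <- [:: false; true], k <- iota 0 3].

(** Directed around the triangle, so that the three paths that replace them can
    be concatenated into a cycle. *)
Definition triangle_arcs (b : bool) : seq ((bool * 'I_3) * (bool * 'I_3)) :=
  [:: (corner b 0, corner b 1); (corner b 1, corner b 2); (corner b 2, corner b 0)].

Definition bridge := (corner false 0, corner true 0).

Definition arcs : seq ((bool * 'I_3) * (bool * 'I_3)) :=
  bridge :: triangle_arcs false ++ triangle_arcs true.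

Lemma corner_eq b k c l : k < 3 -> l < 3 ->
  (corner b k == corner c l) = (b == c) && (k == l).
Proof. by move=> k3 l3; rewrite xpair_eqE -(inj_eq val_inj) /= !inordK. Qed.

Lemma cornerP u : exists b, exists2 k, k < 3 & u = corner b k.
Proof. by case: u => b i; exists b, i; rewrite // /corner inord_val. Qed.

Lemma two_triangles_adjE b k c l : k < 3 -> l < 3 ->
  two_triangles_adj (corner b k) (corner c l) =
    if b == c then k != l else (k == 0) && (l == 0).
Proof.
by move=> k3 l3; rewrite /two_triangles_adj /= -!(inj_eq val_inj) /= !inordK.
Qed.

Lemma oriented_two_triangles : oriented two_triangles corners arcs.
Proof.
have mem_corner u : u \in corners.
  by have [[] [[|[|[|//]]] _ ->]] := cornerP u; rewrite !inE eqxx ?orbT.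
split.
- by rewrite /= !inE !corner_eq.
- by apply/setP=> u; rewrite [RHS]in_set mem_corner; apply: in_setT.
- by rewrite /= !inE /arc_edge !set2_eq /= !corner_eq.
apply/setP=> e; rewrite [in RHS]inE; apply/imset2P/idP=> [[u v _]|].
  have [b [k k3 ->]] := cornerP u; have [c [l l3 ->]] := cornerP v.
  rewrite -[_ \in _]/(two_triangles_adj _ _) two_triangles_adjE // => + ->.
  case: k k3 => [|[|[|//]]] _; case: l l3 => [|[|[|//]]] _; case: b; case: c => // _;
  by rewrite /= !inE /arc_edge !set2_eq /= !corner_eq ?orbT.
case/mapP=> a aA ->; exists a.1 a.2 => //.
rewrite -[_ \in _]/(two_triangles_adj _ _); move: a aA; apply/allP.
by rewrite /= !two_triangles_adjE.
Qed.

(** The vertex [v] and its two neighbours on the cycle serve as branch vertices: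
    the edges at [v] stay undivided and the rest of the cycle is an odd path. *)
Lemma odd_cycle_chord (U : finType) (G : graph U) v s :
  odd_cycle G (v :: s) -> exists a t b, [/\ s = a :: rcons t b,
     ~~ odd (size t), adj G v a, path (adj G) a (rcons t b) & adj G b v].
Proof.
case: s => [|a s]; first by case/and4P.
case/lastP: s => [|t b]; first by case/and4P.
case/and4P=> _ _ + /= /andP[va]; rewrite /= size_rcons /= negbK => ot.
rewrite rcons_path last_rcons => /andP[pt bv].
by exists a, t, b.
Qed.

(** Only the edges opposite the attachment vertices [v] and [w], and the edge
    that joins the triangles, are replaced by paths that may have inner vertices. *)
Lemma dumbbell_subdivision (U : finType) (G : graph U) v s1 i w s2 :
  dumbbell G v s1 i w s2 ->
  exists H, [/\ even_subdivision two_triangles H, subgraph H G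
              & vset H = [set:: (v :: s1) ++ i ++ (w :: s2)]].
Proof.
case=> oc1 oc2 pth oi uD.
have [a1 [t1 [b1 [s1E ot1 va1 pt1 bv1]]]] := odd_cycle_chord oc1.
have [a2 [t2 [b2 [s2E ot2 va2 pt2 bv2]]]] := odd_cycle_chord oc2.
have [uvs _ /map_uniq uarcs _] := oriented_two_triangles.
pose f u := nth v [:: v; a1; b1; w; a2; b2] (index u corners).
(* In the order of [arcs]: the bridge, then each triangle from its corner 0, whose
   second arc is the one opposite that corner. *)
pose s a := nth [::] [:: i; [::]; t1; [::]; [::]; t2; [::]] (index a arcs).
have fE : map f corners = [:: v; a1; b1; w; a2; b2] by apply: map_nth_index.
have sE : map s arcs = [:: i; [::]; t1; [::]; [::]; t2; [::]] by apply: map_nth_index.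
have pD : perm_eq (linkage_vertices corners arcs f s) ((v :: s1) ++ i ++ w :: s2).
  rewrite /linkage_vertices fE sE s1E s2E; apply/permP=> p.
  by rewrite -!cats1 /= !count_cat /= ?count_cat /=; clear; lia.
have [||H [subH HG VH]] :=
  @linkage_subdivision _ _ two_triangles G corners arcs f s oriented_two_triangles.
- move=> u /(map_f f); rewrite fE => fu.
  have : f u \in (v :: s1) ++ (w :: s2).
    rewrite s1E s2E; move: fu; rewrite !(inE, mem_cat, mem_rcons) /=.
    do ![case/predU1P=> [->|]; rewrite ?eqxx ?orbT //].
    by move/eqP->; rewrite eqxx ?orbT.
  by rewrite mem_cat => /orP[]; apply: odd_cycle_vset.
- split; first by rewrite (perm_uniq pD).
  case: fE sE => f0 f1 f2 f3 f4 f5 [h0 h1 h2 h3 h4 h5 h6].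
  apply/allP.
  rewrite /= f0 f1 f2 f3 f4 f5 h0 h1 h2 h3 h4 h5 h6 /=.
  by rewrite oi pth ot1 ot2 va1 pt1 bv1 va2 pt2 bv2.
by exists H; split=> //; rewrite VH; apply/set_seq_eq_mem/perm_mem.
Qed.

(** A subdivided triangle is an odd cycle, since its length is the sum of three odd
    numbers; the connecting path has evenly many inner vertices and is matched
    along itself. *)
Lemma subdivision_covers (U : finType) (G H : graph U) :
  nice G H -> even_subdivision two_triangles H ->
  exists2 cs, cs != [::] & covers G (vset G) cs.
Proof.
case=> -[/subsetP VHG /subsetP EHG] /matchable_del_vertices mGH.
case/(subdivision_linkage oriented_two_triangles)=> f [s [[uT /allP pthA] VH]].
pose cyc b := (f (corner b 0) :: s (corner b 0, corner b 1)) ++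
              (f (corner b 1) :: s (corner b 1, corner b 2)) ++
              (f (corner b 2) :: s (corner b 2, corner b 0)).
pose i := s bridge.
have pT : perm_eq (linkage_vertices corners arcs f s) (i ++ cyc false ++ cyc true).
  apply/permP=> p; rewrite /linkage_vertices /cyc /i.
  by do !rewrite /= !count_cat; rewrite /=; clear; lia.
rewrite (perm_uniq pT) cat_uniq in uT; case/and3P: uT => ui /hasPn iN uc.
have VHE x : (x \in vset H) = (x \in i) || (x \in cyc false ++ cyc true).
  by rewrite VH inE (perm_mem pT) mem_cat.
have pthG a : a \in arcs ->
    ~~ odd (size (s a)) && path (adj G) (f a.1) (rcons (s a) (f a.2)).
  move/(allP pthA)=> /andP[-> pth]; apply: sub_path pth => x y; exact: EHG.
have ocyc b : odd_cycle G (cyc b).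
  have bA : {subset triangle_arcs b <= arcs}.
    by move=> a ab; apply: mem_behead; rewrite mem_cat; case: b ab => ->; rewrite ?orbT.
  have /and4P[/andP[o0 p0] /andP[o1 p1] /andP[o2 p2] _] : all (fun a =>
      ~~ odd (size (s a)) && path (adj G) (f a.1) (rcons (s a) (f a.2)))
      (triangle_arcs b).
    by apply/allP=> a /bA/pthG.
  rewrite /odd_cycle; apply/and4P; split.
  - by move: uc; rewrite cat_uniq => /and3P[]; case: b {bA o0 p0 o1 p1 o2 p2}.
  - by rewrite !size_cat /=; lia.
  - by rewrite !size_cat !oddD /= o0 o1 o2.
  rewrite /cyc /= rcons_cat /= rcons_cat /= -cat_rcons -[X in _ ++ X]cat_rcons.
  by rewrite !cat_path !last_rcons p0 p1 p2.
have flatE : flatten [:: cyc false; cyc true] = cyc false ++ cyc true.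
  by rewrite -[RHS]cats0 -catA.
exists [:: cyc false; cyc true] => //; split; rewrite ?flatE //.
  by apply/allP=> c; rewrite !inE => /orP[]/eqP->; apply: ocyc.
  by move=> x; rewrite mem_cat => /orP[]; apply: odd_cycle_vset.
have iV : {subset i <= vset G} by move=> x xi; rewrite VHG // VHE xi.
have -> : vset G :\: [set:: cyc false ++ cyc true] = (vset G :\: vset H) :|: [set:: i].
  apply/setP=> x; rewrite !(in_setU, in_setD, in_set) VHE.
  have [xi | /= _] := boolP (x \in i); last by rewrite orbF.
  by rewrite (iV x xi) andbT orbT; apply: contraL xi => /iN.
apply: matchableU => //.
  have /pthG/andP[oi /path_sorted] : bridge \in arcs by rewrite mem_head.
  rewrite -cats1 => /cat_sorted2[si _]; exact: matchable_path.
rewrite disjoint_sym disjoints_subset; apply/subsetP=> x; rewrite inE => xi.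
by rewrite in_setC in_setD VHE xi.
Qed.

Theorem theorem1p2 (U : finType) (G : graph U) :
  has_perfect_matching G ->
  (exists H : graph U,
     [/\ spanning_subgraph H G,
         forall C, is_component C H -> is_single_edge C \/ is_odd_cycle C
       & exists C, is_component C H /\ is_odd_cycle C])
  <->
  (exists H : graph U, nice G H /\ even_subdivision two_triangles H).
Proof.
move=> mG; split=> [[H [spanH comps oddH]] | [H [niceH subH]]].
  have [cs cs0 csP] := spanning_covers spanH comps oddH.
  have [v [s1 [i [w [s2 [dG mG']]]]]] := covers_dumbbell mG csP cs0.
  have [K [subK KG VK]] := dumbbell_subdivision dG.
  exists K; split=> //; split=> //.
  by apply/matchable_del_vertices; rewrite VK.
have [cs cs0 csP] := subdivision_covers niceH subH.
exact: covers_spanning cs0 csP.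
Qed.
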